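(* Let $\tau>0$, $M\ge0$, and let a quadrature rule on $\widehat{\mathbb K}$ with distinct points $\widehat{\boldsymbol\xi}_i\in\widehat{\mathbb K}$ and positive weights $\widehat\omega_i>0$, $i=1,\dots,Q$, be given. Let discrete closed surfaces $\Gamma_h^m=\boldsymbol Y_h^m(\widehat\Gamma_h)$ of degree $\ell\ge1$ be generated from a given $\boldsymbol Y_h^0$ as follows: for each $m=0,\dots,M$, the surface $\Gamma_h^m$ satisfies ($\mathcal B1^h$): $|\mathcal J(\boldsymbol Y_h^m|_{\widehat\sigma_j})|(A_j(\widehat{\boldsymbol\xi}_i))>0$ for all $j=1,\dots,J$, $i=1,\dots,Q$; the pair $(\boldsymbol X_h^{m+1},H_h^{m+1})\in[\mathbb W_\ell^m]^3\times\mathbb W_\ell^m$ is a solution of $$\Big(\frac{\boldsymbol X_h^{m+1}-\mathrm{id}}{\tau},\varphi_h\boldsymbol n_h^m\Big)^h_{\Gamma_h^m}=\begin{cases}(H_h^{m+1},\varphi_h)^h_{\Gamma_h^m}, & \text{MCF},\\ (\nabla_{\Gamma_h^m}H_h^{m+1},\nabla_{\Gamma_h^m}\varphi_h)^h_{\Gamma_h^m}, & \text{SD},\end{cases}$$ $$(H_h^{m+1}\boldsymbol n_h^m,\boldsymbol\eta_h)^h_{\Gamma_h^m}+(\nabla_{\Gamma_h^m}\boldsymbol X_h^{m+1},\nabla_{\Gamma_h^m}\boldsymbol\eta_h)^h_{\Gamma_h^m}=0$$ for all $\varphi_h\in\mathbb W_\ell^m$, $\boldsymbol\eta_h\in[\mathbb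 W_\ell^m]^3$ (with the same choice, MCF or SD, for all $m$); and $\boldsymbol Y_h^{m+1}=\boldsymbol X_h^{m+1}\circ\boldsymbol Y_h^m$. Then $$S_h^{M+1}\le S_h^0-\begin{cases}\tau\sum_{m=0}^M(H_h^{m+1},H_h^{m+1})^h_{\Gamma_h^m}, & \text{MCF},\\ \tau\sum_{m=0}^M(\nabla_{\Gamma_h^m}H_h^{m+1},\nabla_{\Gamma_h^m}H_h^{m+1})^h_{\Gamma_h^m}, & \text{SD},\end{cases}$$ where $S_h^m=(1,1)^h_{\Gamma_h^m}$ is the numerical surface area of $\Gamma_h^m$.
   Context: Reference grid. $\widehat{\mathbb K}\subset\mathbb R^2$ is the standard 2-simplex; $\widehat\Gamma_h=\bigcup_{j=1}^J\widehat\sigma_j\subset\mathbb R^3$ is a closed oriented polyhedral surface, conformingly triangulated by flat triangles $\widehat\sigma_j=A_j(\widehat{\mathbb K})$, $A_j$ injective affine maps. On $\widehat\sigma_j$, $\{\widehat{\boldsymbol\tau}_1,\widehat{\boldsymbol\tau}_2\}$ is an orthonormal basis of the tangent space, compatible with the orientation. $\mathbb P^\ell$ denotes polynomials of degree $\le\ell$. Discrete surface. $\boldsymbol Y_h^m:\widehat\Gamma_h\to\mathbb R^3$ is continuous with $\boldsymbol Y_h^m|_{\widehat\sigma_j}\in[\mathbb P^\ell(\widehat\sigma_j)]^3$; $\boldsymbol F_{h,j}^m=\boldsymbol Y_h^m|_{\widehat\sigma_j}\circ A_j$; $\Gamma_h^m=\boldsymbol Y_h^m(\widehat\Gamma_h)$.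 Functions on $\Gamma_h^m$ are identified with their pull-backs under $\boldsymbol Y_h^m$ to $\widehat\Gamma_h$. The finite element space is $$\mathbb W_\ell^m=\{v_h\in H^1(\Gamma_h^m): v_h\circ\boldsymbol Y_h^m|_{\widehat\sigma_j}\in\mathbb P^\ell(\widehat\sigma_j),\ j=1,\dots,J\},$$ i.e. the functions whose pull-back is continuous on $\widehat\Gamma_h$ and polynomial of degree $\le\ell$ on each triangle. $\mathrm{id}$ is the identity on $\Gamma_h^m$ (pull-back $\boldsymbol Y_h^m$). Geometry (piecewise, wherever $|\mathcal J(\boldsymbol Y_h^m)|>0$). $\mathcal J(\boldsymbol Y_h^m)=\partial_{\widehat{\boldsymbol\tau}_1}\boldsymbol Y_h^m\times\partial_{\widehat{\boldsymbol\tau}_2}\boldsymbol Y_h^m$ on $\widehat\sigma_j$; $\mathcal J(\boldsymbol F_{h,j}^m)=\partial_{\boldsymbol e_1}\boldsymbol F_{h,j}^m\times\partial_{\boldsymbol e_2}\boldsymbol F_{h,j}^m$ with $\boldsymbol e_1,\boldsymbol e_2$ the unit vectors of $\mathbb R^2$. $\boldsymbol n_h^m\circ\boldsymbol Y_h^m=\mathcal J(\boldsymbol Y_h^m)/|\mathcal J(\boldsymbol Y_h^m)|$ (orientations chosen so that it is the outer unit normal). $\nabla_{\Gamma_h^m}$ is the piecewise surface gradient on $\Gamma_h^m$: $\nabla_{\Gamma_h^m}f=\sum_{k=1}^2(\partial_{\boldsymbol\tau_k}f)\,\boldsymbol\tau_k$ (for vector-valued $f$: $\sum_k\partial_{\boldsymbol\tau_k}f\otimes\boldsymbol\tau_k$),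 with $\{\boldsymbol\tau_1,\boldsymbol\tau_2\}$ an orthonormal basis of the tangent space of the curved element, i.e. of the range of the derivative of $\boldsymbol Y_h^m|_{\widehat\sigma_j}$. Quadrature inner product. $$(u,v)^h_{\Gamma_h^m}=\sum_{j=1}^J\sum_{i=1}^Q(u\circ\boldsymbol F_{h,j}^m)(\widehat{\boldsymbol\xi}_i)\cdot(v\circ\boldsymbol F_{h,j}^m)(\widehat{\boldsymbol\xi}_i)\,|\mathcal J(\boldsymbol F_{h,j}^m)|(\widehat{\boldsymbol\xi}_i)\,\widehat\omega_i$$ (product, Euclidean or Frobenius inner product for scalars, vectors, matrices; piecewise-defined quantities are evaluated from within element $j$). MCF = mean curvature flow, SD = surface diffusion. *)

(* Defs.v *)
From mathcomp Require Import all_boot all_order all_algebra.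
From mathcomp Require Import all_classical all_reals all_analysis.
From mathcomp Require Import -(notations) mpoly.

Set Implicit Arguments.
Unset Strict Implicit.
Unset Printing Implicit Defensive.

Import Order.TTheory GRing.Theory Num.Theory.
Import numFieldNormedType.Exports.

Local Open Scope classical_set_scope.
Local Open Scope ring_scope.

Definition frob (R : realType) (p q : nat) (u v : 'M[R]_(p, q)) : R :=
  \sum_i \sum_j u i j * v i j.

(* The norm of the library on matrices is the sup norm; this one is Euclidean. *)
Definition enorm (R : realType) (p q : nat) (u : 'M[R]_(p, q)) : R :=
  Num.sqrt (frob u u).

(* Indices are added modulo 3. *)
Definition cross (R : realType) (u v : 'rV[R]_3) : 'rV[R]_3 :=
  \row_(k < 3) (u 0 (k + 1) * v 0 (k + 2) - u 0 (k + 2) * v 0 (k + 1)).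

Definition orthonormal2 (R : realType) (t : 'I_2 -> 'rV[R]_3) : Prop :=
  forall k l, frob (t k) (t l) = (k == l)%:R.

Definition is_diff_within (R : realType) (n : nat) (V : normedModType R)
    (S : set 'rV[R]_n.+1) (f : 'rV[R]_n.+1 -> V) (x : 'rV[R]_n.+1)
    (L : 'rV[R]_n.+1 -> V) : Prop :=
  linear L /\
  forall e : R, 0 < e ->
    \forall y \near within S (nbhs x),
      `|f y - f x - L (y - x)| <= e * `|y - x|.

(* Derivative at x, in the direction v, of the restriction of f to S.  It is
   used when S is a nondegenerate triangle, x is any point of S (corners
   included) and v is tangent to S; then L v is the same for all L with
   is_diff_within S f x L. *)
Definition ddir (R : realType) (n : nat) (V : normedModType R)
    (S : set 'rV[R]_n.+1) (f : 'rV[R]_n.+1 -> V) (x v : 'rV[R]_n.+1) : V :=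
  xget (fun=> 0) [set L | is_diff_within S f x L] v.

Definition simplex (R : realType) : set 'rV[R]_2 :=
  [set x | [/\ 0 <= x 0 0, 0 <= x 0 1 & x 0 0 + x 0 1 <= 1]].
Arguments simplex : clear implicits.

(* The vertices (0,0), (1,0), (0,1) of the standard simplex. *)
Definition ref_vertex (R : realType) (a : 'I_3) : 'rV[R]_2 :=
  \row_(k < 2) (a == k.+1 :> nat)%:R.

Definition segment (R : realType) (p q : 'rV[R]_3) : set 'rV[R]_3 :=
  [set p + t *: (q - p) | t in `[0, 1]].

(* amap j is the parametrization A_j of the j-th triangle, frame j its
   tangential orthonormal basis. *)
Record grid (R : realType) := Grid {
  ntri : nat;
  amap : 'I_ntri -> 'rV[R]_2 -> 'rV[R]_3;
  frame : 'I_ntri -> 'I_2 -> 'rV[R]_3 }.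

Definition triangle (R : realType) (G : grid R) (j : 'I_(ntri G)) :
    set 'rV[R]_3 :=
  amap j @` simplex R.

Definition surface (R : realType) (G : grid R) : set 'rV[R]_3 :=
  \bigcup_(j in [set: 'I_(ntri G)]) triangle j.

Definition vertex (R : realType) (G : grid R) (j : 'I_(ntri G)) (a : 'I_3) :
    'rV[R]_3 :=
  amap j (ref_vertex R a).

Definition tangent (R : realType) (G : grid R) (j : 'I_(ntri G))
    (w : 'rV[R]_3) : Prop :=
  exists c, w = amap j c - amap j 0.

Definition affine_map (R : realType) (f : 'rV[R]_2 -> 'rV[R]_3) : Prop :=
  exists (T : 'M[R]_(2, 3)) (b : 'rV[R]_3), forall x, f x = x *m T + b.

Definition conforming (R : realType) (G : grid R) : Prop :=
  forall i j : 'I_(ntri G), i != j ->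
    [\/ triangle i `&` triangle j = set0,
        exists a b, vertex i a = vertex j b /\
          triangle i `&` triangle j = [set vertex i a]
      | exists a a' b b', [/\ a != a', vertex i a = vertex j b,
          vertex i a' = vertex j b' &
          triangle i `&` triangle j = segment (vertex i a) (vertex i a')]].

Definition edge (R : realType) (G : grid R) (j : 'I_(ntri G))
    (p q : 'rV[R]_3) : Prop :=
  exists a b, [/\ a != b, p = vertex j a & q = vertex j b].

(* The boundary of triangle j, oriented by frame j, runs from p to q along the
   edge pq: the third vertex r lies to the left of it. *)
Definition pos_edge (R : realType) (G : grid R) (j : 'I_(ntri G))
    (p q : 'rV[R]_3) : Prop :=
  exists a b c, [/\ uniq [:: a; b; c], p = vertex j a, q = vertex j b &
    0 < frob (cross (q - p) (vertex j c - p)) (cross (frame j 0) (frame j 1))].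

(* Triangles i and j have the vertex p and an edge containing p in common. *)
Definition adjacent_at (R : realType) (G : grid R) (p : 'rV[R]_3) :
    rel 'I_(ntri G) :=
  fun i j => [&& p \in codom (vertex i), p \in codom (vertex j) &
    has (fun q => (q != p) && (q \in codom (vertex j))) (codom (vertex i))].

(* A conforming triangulation is a closed oriented surface if each edge belongs
   to exactly two triangles, which induce opposite orientations on it, and if
   the triangles around each vertex form a single cycle. *)
Record closed_oriented (R : realType) (G : grid R) : Prop := ClosedOriented {
  co_affine : forall j : 'I_(ntri G), affine_map (amap j);
  co_inj : forall j : 'I_(ntri G), injective (amap j);
  co_tangent : forall (j : 'I_(ntri G)) k, tangent j (frame j k);
  co_orthonormal : forall j : 'I_(ntri G), orthonormal2 (frame j);
  co_conforming : conforming G;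
  co_closed : forall (j : 'I_(ntri G)) p q, edge j p q ->
    exists! i : 'I_(ntri G), i != j /\ edge i p q;
  co_link : forall (i j : 'I_(ntri G)) p,
    p \in codom (vertex i) -> p \in codom (vertex j) ->
    connect (@adjacent_at R G p) i j;
  co_oriented : forall (i j : 'I_(ntri G)) p q,
    i != j -> edge j p q -> pos_edge i p q -> pos_edge j q p }.

Record quadrature (R : realType) := Quadrature {
  npt : nat;
  qpt : 'I_npt -> 'rV[R]_2;
  qwt : 'I_npt -> R }.

Definition quadrature_rule (R : realType) (Q : quadrature R) : Prop :=
  [/\ injective (@qpt R Q), forall i : 'I_(npt Q), simplex R (qpt i) &
      forall i : 'I_(npt Q), 0 < qwt i].

Definition poly_on (R : realType) (l : nat) (S : set 'rV[R]_3)
    (v : 'rV[R]_3 -> R) : Prop :=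
  exists p : mpoly.mpoly 3 R, (mpoly.msize p <= l.+1)%N /\
    forall x, S x -> v x = mpoly.meval (fun i => x 0 i) p.

(* Functions on the discrete surface are represented by their pull-backs to the
   reference surface; the values of the latter outside it are irrelevant. *)
Definition fe (R : realType) (G : grid R) (l : nat) (v : 'rV[R]_3 -> R) : Prop :=
  {within surface G, continuous v} /\
  forall j : 'I_(ntri G), poly_on l (triangle j) v.

Definition fe3 (R : realType) (G : grid R) (l : nat)
    (v : 'rV[R]_3 -> 'rV[R]_3) : Prop :=
  forall k, fe G l (fun x => v x 0 k).

(* Piecewise defined quantities are functions of the index j of a triangle and
   of a point of that triangle. *)
Definition pw (R : realType) (G : grid R) (V : Type) :=
  'I_(ntri G) -> 'rV[R]_3 -> V.

Definition jac (R : realType) (G : grid R) (Y : 'rV[R]_3 -> 'rV[R]_3) :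
    pw G 'rV[R]_3 :=
  fun j x => cross (ddir (triangle j) Y x (frame j 0))
                   (ddir (triangle j) Y x (frame j 1)).

Definition jacF (R : realType) (G : grid R) (Y : 'rV[R]_3 -> 'rV[R]_3)
    (j : 'I_(ntri G)) (xi : 'rV[R]_2) : 'rV[R]_3 :=
  cross (ddir (simplex R) (Y \o amap j) xi (delta_mx 0 0))
        (ddir (simplex R) (Y \o amap j) xi (delta_mx 0 1)).

Definition normal (R : realType) (G : grid R) (Y : 'rV[R]_3 -> 'rV[R]_3) :
    pw G 'rV[R]_3 :=
  fun j x => (enorm (jac Y j x))^-1 *: jac Y j x.

(* w is tangent to triangle j and the derivative of Y at x maps it to t. *)
Definition lifts (R : realType) (G : grid R) (Y : 'rV[R]_3 -> 'rV[R]_3)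
    (j : 'I_(ntri G)) (x t w : 'rV[R]_3) : Prop :=
  tangent j w /\ ddir (triangle j) Y x w = t.

Definition surf_frame (R : realType) (G : grid R) (Y : 'rV[R]_3 -> 'rV[R]_3)
    (j : 'I_(ntri G)) (x : 'rV[R]_3) : 'I_2 -> 'rV[R]_3 :=
  xget (fun=> 0) [set t | orthonormal2 t /\
    forall k, exists w, lifts Y j x (t k) w].

(* Derivative along t of the function on the discrete surface with pull-back f.
   Where jac Y j x <> 0, the lift w of t is unique. *)
Definition surf_ddir (R : realType) (G : grid R) (Y : 'rV[R]_3 -> 'rV[R]_3)
    (V : normedModType R) (f : 'rV[R]_3 -> V) (j : 'I_(ntri G))
    (x t : 'rV[R]_3) : V :=
  ddir (triangle j) f x (xget 0 [set w | lifts Y j x t w]).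

Definition sgrad (R : realType) (G : grid R) (Y : 'rV[R]_3 -> 'rV[R]_3)
    (f : 'rV[R]_3 -> R) : pw G 'rV[R]_3 :=
  fun j x => \sum_(k < 2)
    surf_ddir Y (f : 'rV[R]_3 -> R^o) j x (surf_frame Y j x k) *:
    surf_frame Y j x k.

Definition sgrad3 (R : realType) (G : grid R) (Y : 'rV[R]_3 -> 'rV[R]_3)
    (f : 'rV[R]_3 -> 'rV[R]_3) : pw G 'M[R]_3 :=
  fun j x => \sum_(k < 2)
    (surf_ddir Y f j x (surf_frame Y j x k))^T *m surf_frame Y j x k.

(* dot is the pointwise inner product on V. *)
Definition qip (R : realType) (G : grid R) (Q : quadrature R) (V : Type)
    (dot : V -> V -> R) (Y : 'rV[R]_3 -> 'rV[R]_3) (u v : pw G V) : R :=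
  \sum_(j < ntri G) \sum_(i < npt Q)
    dot (u j (amap j (qpt i))) (v j (amap j (qpt i))) *
    enorm (jacF Y j (qpt i)) * qwt i.
Arguments qip {R} G Q {V} dot Y u v.

Definition num_area (R : realType) (G : grid R) (Q : quadrature R)
    (Y : 'rV[R]_3 -> 'rV[R]_3) : R :=
  qip G Q *%R Y (fun _ _ => 1) (fun _ _ => 1).

Inductive flow := MCF | SD.

Definition flow_form (R : realType) (G : grid R) (Q : quadrature R) (fl : flow)
    (Y : 'rV[R]_3 -> 'rV[R]_3) (u v : 'rV[R]_3 -> R) : R :=
  match fl with
  | MCF => qip G Q *%R Y (fun=> u) (fun=> v)
  | SD => qip G Q (@frob R 1 3) Y (sgrad Y u) (sgrad Y v)
  end.

(* Main.v *)
Require Import Defs.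
From mathcomp Require Import all_boot all_order all_algebra.
From mathcomp Require Import all_classical all_reals all_analysis.
From mathcomp Require Import -(notations) mpoly.
From mathcomp Require Import ring lra.

Set Implicit Arguments.
Unset Strict Implicit.
Unset Printing Implicit Defensive.

Import Order.TTheory GRing.Theory Num.Theory.
Import numFieldNormedType.Exports.

Local Open Scope classical_set_scope.
Local Open Scope ring_scope.

(** The numerical area decreases in each time step.  Write Y for the current
    surface, X and H for the solution of the step.  Testing the first equation
    with H and the second one with X - Y, and eliminating the common term
    (H n, X - Y), gives
      tau * (H, H) + (grad X, grad (X - Y)) = 0,
    where the gradients of H replace H in the case of surface diffusion.  As the
    weights are positive, it remains to prove at each quadrature point that
      |J X| - |J Y| <= <grad X, grad (X - Y)> |J Y|,
    J being the Jacobian of the composition with the chart of the triangle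
    (jacF_le_sgrad3).

    Let t_1, t_2 be the orthonormal basis of the tangent plane of the surface,
    w_k a tangent vector of the triangle that the derivative of Y maps to t_k,
    and a_k its image under the derivative of X.  Then
      <grad X, grad (X - Y)> = sum_k <a_k, a_k - t_k>
                            >= (|a_1|^2 + |a_2|^2) / 2 - 1
                            >= |a_1 x a_2| - 1,
    by frob_polar_le and enorm_cross_le.  If d is the determinant of
    (w_1, w_2) in the basis given by the chart, then |a_1 x a_2| = |d| |J X| and
    1 = |t_1 x t_2| = |d| |J Y| (cross_diff_amap), which turns this into the
    claim.

    Derivatives are taken from within a closed triangle, where a derivative is
    a choice among the linear maps that satisfy the definition.  The chosen map
    obeys the chain rule and additivity because two such maps agree on all
    vectors tangent to the triangle (is_diff_within_simplex_unique), and it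
    exists because finite element functions are polynomial on each triangle
    (fe3_diff_within). *)

(** * Euclidean geometry of vectors and matrices *)

Lemma frobC (R : realType) (p q : nat) (u v : 'M[R]_(p, q)) :
  frob u v = frob v u.
Proof. by apply: eq_bigr => i _; apply: eq_bigr => j _; rewrite mulrC. Qed.

Lemma frobDl (R : realType) (p q : nat) (u v w : 'M[R]_(p, q)) :
  frob (u + v) w = frob u w + frob v w.
Proof.
rewrite /frob -big_split /=; apply: eq_bigr => i _.
by rewrite -big_split /=; apply: eq_bigr => j _; rewrite mxE mulrDl.
Qed.

Lemma frobZl (R : realType) (p q : nat) (a : R) (u w : 'M[R]_(p, q)) :
  frob (a *: u) w = a * frob u w.
Proof.
rewrite /frob mulr_sumr; apply: eq_bigr => i _.
by rewrite mulr_sumr; apply: eq_bigr => j _; rewrite mxE mulrA.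
Qed.

Lemma frobDr (R : realType) (p q : nat) (u v w : 'M[R]_(p, q)) :
  frob w (u + v) = frob w u + frob w v.
Proof. by rewrite !(frobC w) frobDl. Qed.

Lemma frobZr (R : realType) (p q : nat) (a : R) (u w : 'M[R]_(p, q)) :
  frob w (a *: u) = a * frob w u.
Proof. by rewrite !(frobC w) frobZl. Qed.

Lemma frobBr (R : realType) (p q : nat) (u v w : 'M[R]_(p, q)) :
  frob w (u - v) = frob w u - frob w v.
Proof. by rewrite -scaleN1r frobDr frobZr mulN1r. Qed.

Lemma frobBl (R : realType) (p q : nat) (u v w : 'M[R]_(p, q)) :
  frob (u - v) w = frob u w - frob v w.
Proof. by rewrite !(frobC _ w) frobBr. Qed.

Lemma frob_ge0 (R : realType) (p q : nat) (u : 'M[R]_(p, q)) : 0 <= frob u u.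
Proof.
by apply: sumr_ge0 => i _; apply: sumr_ge0 => j _; rewrite -expr2 sqr_ge0.
Qed.

Lemma frob_outer (R : realType) (p q : nat) (a b : 'rV[R]_p) (s t : 'rV[R]_q) :
  frob (a^T *m s) (b^T *m t) = frob a b * frob s t.
Proof.
rewrite /frob !big_ord1 mulr_suml; apply: eq_bigr => i _.
rewrite mulr_sumr; apply: eq_bigr => j _.
by rewrite !mxE !big_ord1 !mxE mulrACA.
Qed.

Lemma enorm_ge0 (R : realType) (p q : nat) (u : 'M[R]_(p, q)) : 0 <= enorm u.
Proof. exact: sqrtr_ge0. Qed.

Lemma sqr_enorm (R : realType) (p q : nat) (u : 'M[R]_(p, q)) :
  enorm u ^+ 2 = frob u u.
Proof. by rewrite sqr_sqrtr ?frob_ge0. Qed.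

Lemma enormZ (R : realType) (p q : nat) (a : R) (u : 'M[R]_(p, q)) :
  enorm (a *: u) = `|a| * enorm u.
Proof.
by rewrite /enorm frobZl frobZr mulrA -expr2 sqrtrM ?sqr_ge0// sqrtr_sqr.
Qed.

Lemma frob3E (R : realType) (u v : 'rV[R]_3) :
  frob u v = u 0 0 * v 0 0 + u 0 1 * v 0 1 + u 0 2%:R * v 0 2%:R.
Proof.
rewrite /frob big_ord1 !big_ord_recl big_ord0 addr0 addrA.
by congr (_ * _ + _ * _ + _ * _); congr (_ 0 _); apply: val_inj.
Qed.

Lemma crossE (R : realType) (u v : 'rV[R]_3) :
  ((cross u v 0 0 = u 0 1 * v 0 2%:R - u 0 2%:R * v 0 1) *
   (cross u v 0 1 = u 0 2%:R * v 0 0 - u 0 0 * v 0 2%:R) *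
   (cross u v 0 2%:R = u 0 0 * v 0 1 - u 0 1 * v 0 0))%type.
Proof.
by do !split; rewrite /cross mxE;
  congr (_ * _ - _ * _); congr (_ 0 _); apply: val_inj.
Qed.

Lemma cross_comb (R : realType) (u v : 'rV[R]_3) (a b c d : R) :
  cross (a *: u + b *: v) (c *: u + d *: v) = (a * d - b * c) *: cross u v.
Proof. by apply/rowP => k; rewrite !mxE; ring. Qed.

Lemma frob_cross (R : realType) (u v : 'rV[R]_3) :
  frob (cross u v) (cross u v) = frob u u * frob v v - frob u v ^+ 2.
Proof. by rewrite !frob3E !crossE; ring. Qed.

(** The area of a parallelogram is at most half the sum of the squares of its
    sides: by Lagrange's identity the squared area is at most the product of
    these squares, and the rest is the inequality of the means. *)
Lemma enorm_cross_le (R : realType) (u v : 'rV[R]_3) :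
  enorm (cross u v) <= (frob u u + frob v v) / 2.
Proof.
have h : 0 <= (frob u u + frob v v) / 2 by rewrite divr_ge0 ?addr_ge0 ?frob_ge0.
rewrite -(ler_pXn2r (ltn0Sn 1)) ?nnegrE ?enorm_ge0// sqr_enorm frob_cross.
have := sqr_ge0 (frob u u - frob v v); have := sqr_ge0 (frob u v).
by rewrite !expr2; nra.
Qed.

Lemma orthonormal_pairP (R : realType) (t : 'I_2 -> 'rV[R]_3) :
  orthonormal2 t <->
  [/\ frob (t 0) (t 0) = 1, frob (t 1) (t 1) = 1 & frob (t 0) (t 1) = 0].
Proof.
split=> [ont|[e0 e1 e01] k l]; first by split; rewrite ont.
have ord2 (i : 'I_2) : i = 0 \/ i = 1.
  by case: i => -[|[|//]] lti; [left|right]; apply: val_inj.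
by have [->|->] := ord2 k; have [->|->] := ord2 l; rewrite // frobC.
Qed.

Lemma enorm_cross_orthonormal (R : realType) (t : 'I_2 -> 'rV[R]_3) :
  orthonormal2 t -> enorm (cross (t 0) (t 1)) = 1.
Proof.
move=> /orthonormal_pairP[e0 e1 e01]; rewrite /enorm frob_cross e0 e1 e01.
by rewrite expr0n subr0 mulr1 sqrtr1.
Qed.

Lemma frob_sum_outer (R : realType) (t a b : 'I_2 -> 'rV[R]_3) :
  orthonormal2 t ->
  frob (\sum_(k < 2) (a k)^T *m t k) (\sum_(k < 2) (b k)^T *m t k) =
  frob (a 0) (b 0) + frob (a 1) (b 1).
Proof.
move=> /orthonormal_pairP[e0 e1 e01].
have sum2 (F : 'I_2 -> 'M[R]_3) : \sum_(k < 2) F k = F 0 + F 1.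
  rewrite !big_ord_recl big_ord0 addr0.
  by congr (_ + F _); apply: val_inj.
rewrite !sum2 !frobDl !frobDr !frob_outer e0 e1 (frobC (t 1)) e01.
by rewrite !mulr0 !mulr1 addr0 add0r.
Qed.

(** The polarization identity for 2 <u, u - v>, without its nonnegative term
    |u - v|^2. *)
Lemma frob_polar_le (R : realType) (p q : nat) (u v : 'M[R]_(p, q)) :
  frob u u - frob v v <= 2 * frob u (u - v).
Proof.
have := frob_ge0 (u - v); rewrite !frobBr !frobBl (frobC v u).
by move: (frob u u) (frob u v) (frob v v) => x y z; lra.
Qed.

(** Gram-Schmidt: the vector |u|^2 v - <u, v> u is orthogonal to u and, by
    Lagrange's identity, has the length |u| |u x v|. *)
Lemma orthonormal_comb (R : realType) (u v : 'rV[R]_3) :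
  0 < enorm (cross u v) ->
  exists c : 'I_2 -> R * R,
    orthonormal2 (fun k => (c k).1 *: u + (c k).2 *: v).
Proof.
move=> J0; set J := enorm (cross u v) in J0 *; set n := enorm u.
have EJ : J ^+ 2 = n ^+ 2 * frob v v - frob u v ^+ 2.
  by rewrite sqr_enorm frob_cross sqr_enorm.
have n0 : n != 0.
  apply: contraTneq (J0) => n0; rewrite -leNgt.
  rewrite -(ler_pXn2r (ltn0Sn 1)) ?nnegrE ?enorm_ge0//.
  by rewrite EJ n0 expr0n mul0r sub0r oppr_le0 sqr_ge0.
have J0' : J != 0 by rewrite gt_eqF.
have En : frob u u = n ^+ 2 by rewrite sqr_enorm.
exists (fun k => if k == 0 then (n^-1, 0) else (- frob u v / (n * J), n / J)).
apply/orthonormal_pairP; rewrite /=.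
rewrite !frobDl !frobDr !frobZl !frobZr En (frobC v u).
split.
- by field.
- apply: (mulfI (expf_neq0 2 J0')); rewrite mulr1 [RHS]EJ; field.
  by rewrite J0'.
- by field; rewrite J0'.
Qed.

(** * Derivatives of functions restricted to a set *)

Lemma rV_normP (R : realType) (n : nat) (u : 'rV[R]_n.+1) (e : R) :
  0 <= e -> (`|u| <= e <-> forall k, `|u 0 k| <= e).
Proof.
move=> e0; rewrite {1}/Num.norm /= mx_normrE; split=> [ue k|ue].
  by apply: le_trans ue; exact: (le_bigmax _ (fun p => `|u p.1 p.2|) (0, k)).
by apply: bigmax_le => // -[i k] _; rewrite (ord1 i); exact: ue.
Qed.

Lemma normr_mulmx_le (R : realType) (n p : nat) (T : 'M[R]_(n.+1, p.+1)) :
  exists2 C : R, 0 < C & forall c : 'rV[R]_n.+1, `|c *m T| <= C * `|c|.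
Proof.
have T0 : 0 <= \sum_i \sum_k `|T i k|.
  by apply: sumr_ge0 => i _; apply: sumr_ge0.
(* The 1 makes the constant positive also when T is zero. *)
exists (1 + \sum_i \sum_k `|T i k|); first by rewrite ltr_pwDl.
move=> c; have [|_ H] := @rV_normP R p (c *m T)
    ((1 + \sum_i \sum_k `|T i k|) * `|c|).
  by rewrite mulr_ge0 ?addr_ge0.
apply: H => k; rewrite mxE (le_trans (ler_norm_sum _ _ _))//.
rewrite mulrDl mul1r ler_wpDl// mulr_suml ler_sum// => i _.
rewrite normrM mulrC ler_pM//.
  by rewrite (bigD1 k)//= lerDl sumr_ge0.
by have [cE _] := @rV_normP R n c `|c| (normr_ge0 _); exact: cE.
Qed.

Lemma linear_scale (R : pzRingType) (U V : lmodType R) (L : U -> V) :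
  linear L -> forall a u, L (a *: u) = a *: L u.
Proof.
move=> linL a u; have L0 : L 0 = 0.
  apply: (@addIr _ (L 0)).
  by rewrite -{1}(scale1r (L 0)) -linL scaler0 !add0r.
by rewrite -[a *: u]addr0 linL L0 addr0.
Qed.

Lemma linear_comb (R : pzRingType) (U V : lmodType R) (L : U -> V) :
  linear L -> forall a b u v, L (a *: u + b *: v) = a *: L u + b *: L v.
Proof. by move=> linL a b u v; rewrite linL (linear_scale linL). Qed.

Section DiffWithin.
Variables (R : realType) (n : nat) (V : normedModType R).
Implicit Types (S : set 'rV[R]_n.+1) (f g : 'rV[R]_n.+1 -> V).

(** Moving from x towards a point p of S inside S determines the derivative
    along p - x. *)
Lemma is_diff_within_unique S f x L1 L2 p :
  (forall t : R, 0 <= t <= 1 -> S (x + t *: (p - x))) ->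
  is_diff_within S f x L1 -> is_diff_within S f x L2 ->
  L1 (p - x) = L2 (p - x).
Proof.
move=> Sseg [lin1 d1] [lin2 d2]; set h := p - x.
apply/eqP; rewrite -subr_eq0 -normr_eq0; apply/negPn; apply/negP => d_neq0.
(* L1 (t h) and L2 (t h) both differ from f (x + t h) - f x by at most e t |h|
   for small t, so d <= 2 e |h|; the e below makes the right side smaller
   than d.  Adding 1 to |h| avoids a division by zero. *)
set d := `|L1 h - L2 h| in d_neq0.
have d0 : 0 < d by rewrite lt_def d_neq0 normr_ge0.
have h1 : 0 < `|h| + 1 by rewrite ltr_wpDl.
pose e := d / (4 * (`|h| + 1)).
have e0 : 0 < e by rewrite divr_gt0// mulr_gt0.
have /nbhs_normP[r /= r0 rS] : nbhs x (fun y => S y ->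
    `|f y - f x - L1 (y - x)| <= e * `|y - x| /\
    `|f y - f x - L2 (y - x)| <= e * `|y - x|).
  have := d1 _ e0; have := d2 _ e0; rewrite !near_withinE.
  by apply: filterS2 => y le2 le1 Sy; split; [exact: le1|exact: le2].
pose t := Num.min 1 (r / (2 * (`|h| + 1))).
have t0 : 0 < t by rewrite lt_min ltr01 divr_gt0// mulr_gt0.
have t1 : t <= 1 by rewrite ge_min lexx.
have th : t * (`|h| + 1) <= r / 2.
  rewrite -ler_pdivlMr// ge_min; apply/orP; right.
  by rewrite invfM mulrA.
have [||b1 b2] := rS (x + t *: h).
- rewrite /ball_ /= opprD addNKr normrN normrZ gtr0_norm//.
  have := ler_wpM2l (ltW t0) (_ : `|h| <= `|h| + 1).
  rewrite lerDl => /(_ ler01).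
  move: r0 th; set a := t * `|h|; set b := t * (_ + _); lra.
- by apply: Sseg; rewrite ltW.
have {b1 b2} : t * d <= 2 * (e * (t * `|h|)).
  rewrite -[t in t * d]gtr0_norm// -normrZ scalerBr.
  rewrite -(linear_scale lin1) -(linear_scale lin2).
  move: b1 b2; rewrite (addrC x) !addrK normrZ (gtr0_norm t0).
  set w := _ - f x; set e' := e * _ => b1 b2.
  rewrite (_ : _ - _ = (w - L2 (t *: h)) - (w - L1 (t *: h))); last first.
    by rewrite opprB [RHS]addrC addrA subrK.
  by rewrite (le_trans (ler_normB _ _))// mulr2n mulrDl mul1r lerD.
rewrite (mulrCA e) (mulrCA 2) ler_pM2l// leNgt => /negP; apply.
have -> : d = e * (4 * (`|h| + 1)) by rewrite divfK// gt_eqF// mulr_gt0.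
by rewrite mulrCA ltr_pM2l//; have := normr_ge0 h; lra.
Qed.

Lemma ddirP S f x : (exists L, is_diff_within S f x L) ->
  is_diff_within S f x (ddir S f x).
Proof. exact: xgetPex. Qed.

Lemma is_diff_within_eq S f g x L : S x -> {in S, f =1 g} ->
  is_diff_within S f x L -> is_diff_within S g x L.
Proof.
move=> Sx fg [linL dL]; split=> // e e0; have := dL e e0.
rewrite !near_withinE; apply: filterS => y + Sy => /(_ Sy).
by rewrite !fg ?inE.
Qed.

Lemma ddir_eq S f g x v : S x -> {in S, f =1 g} -> ddir S f x v = ddir S g x v.
Proof.
move=> Sx fg; rewrite /ddir.
suff -> : is_diff_within S f x = is_diff_within S g x by [].
rewrite funeqE => L; rewrite propeqE; split; apply: is_diff_within_eq => //.
by move=> y Sy; rewrite fg.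
Qed.

Lemma is_diff_withinB S f g x L K :
  is_diff_within S f x L -> is_diff_within S g x K ->
  is_diff_within S (fun y => f y - g y) x (fun v => L v - K v).
Proof.
move=> [linL dL] [linK dK]; split.
  by move=> a u v; rewrite linL linK opprD addrACA scalerBr.
move=> e e0; have e2 : 0 < e / 2 by rewrite divr_gt0.
have := dL _ e2; have := dK _ e2; rewrite !near_withinE.
apply: filterS2 => y Hg Hf Sy.
have -> : f y - g y - (f x - g x) - (L (y - x) - K (y - x)) =
    (f y - f x - L (y - x)) - (g y - g x - K (y - x)).
  have E (a b c d : V) : a - b - (c - d) = a - c - (b - d).
    by rewrite !opprD !opprK addrACA.
  by rewrite (E _ (g y)) [LHS]E.
rewrite (le_trans (ler_normB _ _))// [e in e * _]splitr mulrDl.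
by rewrite lerD ?Hf ?Hg.
Qed.

Lemma is_diff_within_comp_affine (p : nat) (S : set 'rV[R]_p.+1) S' f
    (T : 'M[R]_(p.+1, n.+1)) b x L :
  (forall y, S y -> S' (y *m T + b)) ->
  is_diff_within S' f (x *m T + b) L ->
  is_diff_within S (fun y => f (y *m T + b)) x (fun v => L (v *m T)).
Proof.
move=> SS' [linL dL]; split.
  by move=> a u v; rewrite mulmxDl -scalemxAl linL.
have [C C0 HC] := normr_mulmx_le T.
move=> e e0; have eC0 : 0 < e / C by rewrite divr_gt0.
have := dL _ eC0; rewrite !near_withinE => /nbhs_normP[r /= r0 rS].
apply: (nbhs_normP x _).2; exists (r / C); first by rewrite /= divr_gt0.
move=> y /=; rewrite /ball_ /= ltr_pdivlMr// mulrC => xy Sy.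
have E : y *m T + b - (x *m T + b) = (y - x) *m T.
  by rewrite mulmxBl opprD addrACA subrr addr0.
have := rS (y *m T + b); rewrite /ball_ /= -normrN opprB E => H.
rewrite (le_trans (H _ (SS' _ Sy)))//.
  by rewrite (le_lt_trans (HC _))// distrC.
by rewrite -mulrA ler_wpM2l ?(ltW e0)// ler_pdivrMl.
Qed.

End DiffWithin.

(** * Finite element functions *)

Lemma differentiable_meval (R : realType) (n : nat) (p : mpoly n.+1 R)
    (x : 'rV[R]_n.+1) :
  differentiable (fun y : 'rV[R]_n.+1 => meval (fun i => y 0 i) p : R) x.
Proof.
have dmono (m : multinom n.+1) (s : seq 'I_n.+1) :
    differentiable (fun y : 'rV[R]_n.+1 =>
      \prod_(i <- s) y 0 i ^+ fun_of_multinom m i : R) x.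
  elim: s => [|i s IH].
    by under eq_fun do rewrite big_nil; exact: differentiable_cst.
  under eq_fun do rewrite big_cons.
  apply: differentiableM => //; elim: (fun_of_multinom m i) => [|k IHk].
    by under eq_fun do rewrite expr0; exact: differentiable_cst.
  under eq_fun do rewrite exprS.
  by apply: differentiableM => //; exact: differentiable_coord.
under eq_fun do rewrite mevalE.
elim: (msupp _) => [|m s IH].
  by under eq_fun do rewrite big_nil; exact: differentiable_cst.
under eq_fun do rewrite big_cons.
by apply: differentiableD => //; apply: differentiableM => //.
Qed.

Lemma differentiable_diff_within (R : realType) (n : nat)
    (V : normedModType R) (f : 'rV[R]_n.+1 -> V) S x :
  differentiable f x -> is_diff_within S f x ('d f x).
Proof.
move=> /diff_locallyP[_ /eqaddoP df]; split; first exact: linearP.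
move=> e e0; rewrite near_withinE; have /nbhs_normP[r r0 rS] := df e e0.
apply: (nbhs_normP x _).2; exists r => // y /= xy _.
have := rS (y - x); rewrite /ball_ /= sub0r normrN distrC => /(_ xy).
by rewrite fctE /= subrK opprD addrA.
Qed.

(** On a triangle each component is the restriction of a polynomial, whose
    differential serves as derivative from within the triangle. *)
Lemma fe3_diff_within (R : realType) (G : grid R) l v (j : 'I_(ntri G)) x :
  fe3 G l v -> triangle j x ->
  exists L, is_diff_within (triangle j) v x L.
Proof.
move=> fev jx.
have comp k : exists K,
    is_diff_within (triangle j) (fun y => v y 0 k : R^o) x K.
  have [_ /(_ j)[p [_ Ep]]] := fev k.
  exists ('d (fun y : 'rV[R]_3 => meval (fun i => y 0 i) p : R^o) x).
  apply: is_diff_within_eq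
    (differentiable_diff_within _ (differentiable_meval p x)) => //.
  by move=> y; rewrite inE => /Ep ->.
have [K HK] := choice comp.
exists (fun h => \row_k K k h); split.
  by move=> a u w; apply/rowP => k; rewrite !mxE; have [-> _] := HK k.
move=> e e0; have H : \forall y \near within (triangle j) (nbhs x),
    forall k, `|v y 0 k - v x 0 k - K k (y - x)| <= e * `|y - x|.
  by apply: filter_forall => k; have [_] := HK k; exact.
apply: filterS H => y H.
have [|_] := @rV_normP R 2 (v y - v x - \row_k K k (y - x)) (e * `|y - x|).
  by rewrite mulr_ge0// ltW.
by apply=> k; rewrite !mxE.
Qed.

Lemma poly_onB (R : realType) l S (u v : 'rV[R]_3 -> R) :
  poly_on l S u -> poly_on l S v -> poly_on l S (fun x => u x - v x).
Proof.
move=> [p [sp Ep]] [q [sq Eq]]; exists (p - q); split.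
  by rewrite (leq_trans (msizeD_le _ _))// geq_max sp msizeN.
by move=> x Sx; rewrite Ep// Eq// mevalB.
Qed.

Lemma fe3B (R : realType) (G : grid R) l u v :
  fe3 G l u -> fe3 G l v -> fe3 G l (fun x => u x - v x).
Proof.
move=> feu fev k; have [cu pu] := feu k; have [cv pv] := fev k.
have -> : (fun x => (u x - v x) 0 k) = (fun x => u x 0 k - v x 0 k).
  by apply/funext => x; rewrite !mxE.
split; last by move=> j; exact: poly_onB.
have := within_continuousB (V := R^o) cu cv; exact.
Qed.

Lemma triangle_surface (R : realType) (G : grid R) (j : 'I_(ntri G)) x :
  triangle j x -> surface G x.
Proof. by move=> jx; exists j. Qed.

Lemma fe3_eq (R : realType) (G : grid R) l u v :
  (forall x, surface G x -> v x = u x) -> fe3 G l u -> fe3 G l v.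
Proof.
move=> vu feu k; have [cu pu] := feu k; split.
  apply: (subspace_eq_continuous (f := fun x => u x 0 k)
    (g := fun x => v x 0 k)) cu => x.
  by rewrite inE => Ax; rewrite vu.
move=> j; have [p [sp Ep]] := pu j; exists p; split=> // x jx.
by rewrite vu ?Ep//; exact: triangle_surface jx.
Qed.

(** * Transport to the standard simplex *)

Lemma row2_sum_delta (R : realType) (c : 'rV[R]_2) :
  c = c 0 0 *: delta_mx 0 0 + c 0 1 *: delta_mx 0 1.
Proof.
rewrite [LHS]row_sum_delta !big_ord_recl big_ord0 addr0.
by congr (_ + c 0 _ *: delta_mx 0 _); apply: val_inj.
Qed.

(** The differences p - x, for the points p of the simplex, span the plane even
    when x is a corner: the unit vectors are differences of two of them. *)
Lemma is_diff_within_simplex_unique (R : realType) (V : normedModType R)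
    (f : 'rV[R]_2 -> V) x L1 L2 :
  simplex R x -> is_diff_within (simplex R) f x L1 ->
  is_diff_within (simplex R) f x L2 -> L1 = L2.
Proof.
move=> Sx d1 d2; have [lin1 _] := d1; have [lin2 _] := d2.
have key p : simplex R p -> L1 (p - x) = L2 (p - x).
  move=> Sp; apply: is_diff_within_unique d1 d2 => t /andP[t0 t1].
  case: Sx Sp => x0 x1 x2 [p0 p1 p2].
  by split; rewrite !mxE; nra.
have S0 : simplex R 0 by split; rewrite !mxE ?addr0.
have Sd k : simplex R (delta_mx 0 k).
  split; rewrite !mxE ?ler0n//.
  by case: k => -[|[|k]] lti; rewrite /= ?addr0 ?add0r.
have L12d k : L1 (delta_mx 0 k) = L2 (delta_mx 0 k).
  have -> : delta_mx 0 k = 1 *: (delta_mx 0 k - x) + (-1) *: (0 - x) :> 'rV_2.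
    by rewrite scale1r scaleN1r sub0r opprK subrK.
  by rewrite !linear_comb// !key.
by apply/funext => c; rewrite (row2_sum_delta c) !linear_comb// !L12d.
Qed.

Section Transport.
Variables (R : realType) (G : grid R) (j : 'I_(ntri G)).
Variables (T : 'M[R]_(2, 3)) (b : 'rV[R]_3).
Hypothesis amapE : forall xi, amap j xi = xi *m T + b.

Lemma tangentP w : tangent j w <-> exists c, w = c *m T.
Proof.
by split=> -[c ->]; exists c; rewrite !amapE mul0mx add0r addrK.
Qed.

Lemma triangle_amap xi : simplex R xi -> triangle j (amap j xi).
Proof. by move=> Sxi; exists xi. Qed.

(** The chain rule for the affine chart of the triangle. *)
Lemma is_diff_within_amap (f : 'rV[R]_3 -> 'rV[R]_3) xi L :
  is_diff_within (triangle j) f (amap j xi) L ->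
  is_diff_within (simplex R) (f \o amap j) xi (fun c => L (c *m T)).
Proof.
have -> : f \o amap j = fun y => f (y *m T + b).
  by apply/funext => y /=; rewrite amapE.
rewrite amapE; apply: is_diff_within_comp_affine => y Sy.
by rewrite -amapE; exact: triangle_amap.
Qed.

(** By the chain rule a derivative from within the triangle is determined on
    tangent vectors, since the one from within the simplex is. *)
Lemma ddir_tangent (f : 'rV[R]_3 -> 'rV[R]_3) xi L w :
  simplex R xi -> is_diff_within (triangle j) f (amap j xi) L ->
  tangent j w -> ddir (triangle j) f (amap j xi) w = L w.
Proof.
move=> Sxi dL /tangentP[c ->].
have dD := ddirP (ex_intro _ L dL).
have E := is_diff_within_simplex_unique Sxi (is_diff_within_amap dD)
            (is_diff_within_amap dL).
exact: (congr1 (@^~ c) E).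
Qed.

(** Both factors are combinations of the images of the two unit vectors, so
    their cross product carries the determinant of the coefficients. *)
Lemma cross_diff_amap (f : 'rV[R]_3 -> 'rV[R]_3) xi L (c d : 'rV[R]_2) :
  simplex R xi -> is_diff_within (triangle j) f (amap j xi) L ->
  cross (L (c *m T)) (L (d *m T)) =
  (c 0 0 * d 0 1 - c 0 1 * d 0 0) *: jacF f j xi.
Proof.
move=> Sxi dL; have dC := is_diff_within_amap dL; have [linC _] := dC.
have E : ddir (simplex R) (f \o amap j) xi = (fun c => L (c *m T)).
  exact: is_diff_within_simplex_unique Sxi (ddirP (ex_intro _ _ dC)) dC.
rewrite /jacF E -cross_comb -!(linear_comb linC).
by rewrite -!row2_sum_delta.
Qed.

End Transport.

(** * The discrete surface gradient *)

(** Where the Jacobian is not zero, Gram-Schmidt applied to the images of the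
    reference frame gives an orthonormal frame with lifts, so the choice in
    surf_frame is made from a nonempty set. *)
Lemma surf_frameP (R : realType) (G : grid R) (Y : 'rV[R]_3 -> 'rV[R]_3)
    (j : 'I_(ntri G)) (x : 'rV[R]_3) :
  closed_oriented G ->
  (exists L, is_diff_within (triangle j) Y x L) -> 0 < enorm (jac Y j x) ->
  orthonormal2 (surf_frame Y j x) /\
  forall k, exists w, lifts Y j x (surf_frame Y j x k) w.
Proof.
move=> hG /ddirP[linY _] J0.
apply: (@xgetPex _ (fun=> 0) [set t | orthonormal2 t /\
    forall k, exists w, lifts Y j x (t k) w]).
have [c oc] := orthonormal_comb J0.
exists (fun k => (c k).1 *: ddir (triangle j) Y x (frame j 0) +
                 (c k).2 *: ddir (triangle j) Y x (frame j 1)).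
split=> // k; exists ((c k).1 *: frame j 0 + (c k).2 *: frame j 1).
split; last by rewrite linear_comb.
have [T [b amapE]] := co_affine hG j.
have [c0 E0] := (tangentP amapE _).1 (co_tangent hG j 0).
have [c1 E1] := (tangentP amapE _).1 (co_tangent hG j 1).
apply/(tangentP amapE); exists ((c k).1 *: c0 + (c k).2 *: c1).
by rewrite mulmxDl -!scalemxAl -E0 -E1.
Qed.

(** The pointwise estimate behind the decrease of the area.  The gradients of X
    and of X - Y are expanded with the same frame t and the same lifts w, so
    the derivative of X - Y along w k is a k - t k. *)
Lemma jacF_le_sgrad3 (R : realType) (G : grid R) (X Y : 'rV[R]_3 -> 'rV[R]_3)
    (j : 'I_(ntri G)) (xi : 'rV[R]_2) :
  closed_oriented G -> simplex R xi ->
  (exists L, is_diff_within (triangle j) X (amap j xi) L) ->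
  (exists L, is_diff_within (triangle j) Y (amap j xi) L) ->
  0 < enorm (jac Y j (amap j xi)) ->
  enorm (jacF X j xi) - enorm (jacF Y j xi) <=
  frob (sgrad3 Y X j (amap j xi)) (sgrad3 Y (fun x => X x - Y x) j (amap j xi))
  * enorm (jacF Y j xi).
Proof.
(* D is the modulus of the determinant of the lifts; it is eliminated because
   D * JY = 1. *)
have conclude (D JX JY A0 A1 s0 s1 : R) : 1 = D * JY -> 0 <= JY ->
    A0 - 1 <= 2 * s0 -> A1 - 1 <= 2 * s1 -> D * JX <= (A0 + A1) / 2 ->
    JX - JY <= (s0 + s1) * JY.
  move=> dJY JY0 y0 y1 area.
  have : (D * JX - 1) * JY <= (s0 + s1) * JY by apply: ler_wpM2r => //; lra.
  by rewrite mulrBl mul1r mulrAC -dJY mul1r.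
move=> hG Sxi /ddirP dX /ddirP dY J0.
have [T [b amapE]] := co_affine hG j.
set x := amap j xi in dX dY J0 *.
have [ont lift] := surf_frameP hG (ex_intro _ _ dY) J0.
set t := surf_frame Y j x in ont lift.
pose w k := xget 0 [set w | lifts Y j x (t k) w].
have wP k : lifts Y j x (t k) (w k) by exact: xgetPex (lift k).
have tanw k : tangent j (w k) by have [] := wP k.
set DX := ddir (triangle j) X x in dX *.
set DY := ddir (triangle j) Y x in dY *.
pose a k : 'rV[R]_3 := DX (w k).
have DYw k : DY (w k) = t k by have [] := wP k.
have gradX : sgrad3 Y X j x = \sum_(k < 2) (a k)^T *m t k by [].
have gradB : sgrad3 Y (fun y => X y - Y y) j x =
    \sum_(k < 2) (a k - t k)^T *m t k.
  apply: eq_bigr => k _; congr (_^T *m _); rewrite -DYw.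
  exact: (ddir_tangent amapE Sxi (is_diff_withinB dX dY) (tanw k)).
rewrite gradX gradB frob_sum_outer//.
have [c0 E0] := (tangentP amapE _).1 (tanw 0).
have [c1 E1] := (tangentP amapE _).1 (tanw 1).
have crossX := cross_diff_amap amapE c0 c1 Sxi dX.
have crossY := cross_diff_amap amapE c0 c1 Sxi dY.
rewrite -E0 -E1 in crossX crossY.
set d := _ - _ in crossX crossY.
have dJX : enorm (cross (a 0) (a 1)) = `|d| * enorm (jacF X j xi).
  by rewrite -enormZ -crossX.
have dJY : 1 = `|d| * enorm (jacF Y j xi).
  by rewrite -enormZ -crossY !DYw enorm_cross_orthonormal.
have [e0 e1 _] := (orthonormal_pairP _).1 ont.
have area := enorm_cross_le (a 0) (a 1); rewrite dJX in area.
have y0 := frob_polar_le (a 0) (t 0); rewrite e0 in y0.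
have y1 := frob_polar_le (a 1) (t 1); rewrite e1 in y1.
exact: conclude dJY (enorm_ge0 _) y0 y1 area.
Qed.

(** * The energy estimate *)

Lemma num_area_eq (R : realType) (G : grid R) (Q : quadrature R) X Y :
  closed_oriented G -> quadrature_rule Q ->
  (forall x, surface G x -> Y x = X x) -> num_area G Q Y = num_area G Q X.
Proof.
move=> hG [_ Qs _] YX; apply: eq_bigr => j _; apply: eq_bigr => i _.
have ddirE v : ddir (simplex R) (Y \o amap j) (qpt i) v =
    ddir (simplex R) (X \o amap j) (qpt i) v.
  apply: ddir_eq (Qs i) _ => xi; rewrite inE => Sxi /=.
  by apply: YX; exists j => //; exists xi.
by rewrite /jacF !ddirE.
Qed.

(** With the test function X - Y the curvature equation identifies the
    dissipation tau * flow_form with minus the gradient term, whose integrand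
    bounds the change of the area element at each quadrature point. *)
Lemma num_area_step (R : realType) (G : grid R) (Q : quadrature R)
    (l : nat) (tau : R) (fl : flow)
    (Y X : 'rV[R]_3 -> 'rV[R]_3) (H : 'rV[R]_3 -> R) :
  closed_oriented G -> quadrature_rule Q -> 0 < tau ->
  fe3 G l Y -> fe3 G l X -> fe G l H ->
  (forall (j : 'I_(ntri G)) (i : 'I_(npt Q)),
    0 < enorm (jac Y j (amap j (qpt i)))) ->
  (forall phi, fe G l phi ->
    qip G Q (@frob R 1 3) Y
      (fun _ x => tau^-1 *: (X x - Y x)) (fun j x => phi x *: normal Y j x)
    = flow_form G Q fl Y H phi) ->
  (forall eta, fe3 G l eta ->
    qip G Q (@frob R 1 3) Y (fun j x => H x *: normal Y j x) (fun=> eta)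
    + qip G Q (@frob R 3 3) Y (sgrad3 Y X) (sgrad3 Y eta) = 0) ->
  num_area G Q X <= num_area G Q Y - tau * flow_form G Q fl Y H H.
Proof.
have weigh (w u v s : R) : 0 <= w -> u - v <= s * v ->
    1 * 1 * u * w - 1 * 1 * v * w <= s * v * w.
  by move=> w0 uv; rewrite !mul1r -mulrBl ler_wpM2r.
move=> hG [_ Qs Qw] tau0 feY feX feH B1 velocity curvature.
have := curvature _ (fe3B feX feY).
have -> : qip G Q (@frob R 1 3) Y (fun j x => H x *: normal Y j x)
    (fun _ x => X x - Y x) = tau * flow_form G Q fl Y H H.
  rewrite -velocity// mulr_sumr; apply: eq_bigr => j _.
  rewrite mulr_sumr; apply: eq_bigr => i _.
  by rewrite [in RHS]frobZl [in LHS]frobC !mulrA divff ?gt_eqF// mul1r.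
move=> /eqP; rewrite addrC addr_eq0 => /eqP <-; rewrite -lerBlDl.
rewrite -sumrB; apply: ler_sum => j _; rewrite -sumrB; apply: ler_sum => i _.
apply: weigh (ltW (Qw i)) (jacF_le_sgrad3 hG (Qs i) _ _ (B1 j i)).
  by apply: fe3_diff_within feX _; exists (qpt i).
by apply: fe3_diff_within feY _; exists (qpt i).
Qed.

Theorem theorem3p3 (R : realType) (G : grid R) (Q : quadrature R)
    (l M : nat) (tau : R) (fl : flow)
    (Y X : nat -> 'rV[R]_3 -> 'rV[R]_3) (H : nat -> 'rV[R]_3 -> R)
    (hG : closed_oriented G) (hQ : quadrature_rule Q)
    (hl : (1 <= l)%N) (htau : 0 < tau)
    (hY0 : fe3 G l (Y 0%N))
    (hB1 : forall m, (m <= M)%N ->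
      forall (j : 'I_(ntri G)) (i : 'I_(npt Q)),
        0 < enorm (jac (Y m) j (amap j (qpt i))))
    (hX : forall m, (m <= M)%N -> fe3 G l (X m.+1))
    (hH : forall m, (m <= M)%N -> fe G l (H m.+1))
    (hvelocity : forall m, (m <= M)%N -> forall phi, fe G l phi ->
      qip G Q (@frob R 1 3) (Y m)
        (fun _ x => tau^-1 *: (X m.+1 x - Y m x))
        (fun j x => phi x *: normal (Y m) j x)
      = flow_form G Q fl (Y m) (H m.+1) phi)
    (hcurvature : forall m, (m <= M)%N -> forall eta, fe3 G l eta ->
      qip G Q (@frob R 1 3) (Y m)
        (fun j x => H m.+1 x *: normal (Y m) j x) (fun=> eta)
      + qip G Q (@frob R 3 3) (Y m)
        (sgrad3 (Y m) (X m.+1)) (sgrad3 (Y m) eta) = 0)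
    (hY : forall m, (m <= M)%N -> forall x, surface G x ->
      Y m.+1 x = X m.+1 x) :
  num_area G Q (Y M.+1) <=
  num_area G Q (Y 0%N)
  - tau * \sum_(0 <= m < M.+1) flow_form G Q fl (Y m) (H m.+1) (H m.+1).
Proof.
have feY m : (m <= M)%N -> fe3 G l (Y m).
  by case: m => // m /ltnW mM; exact: fe3_eq (hY m mM) (hX m mM).
suff decrease n : (n <= M.+1)%N -> num_area G Q (Y n) <= num_area G Q (Y 0%N)
    - tau * \sum_(0 <= m < n) flow_form G Q fl (Y m) (H m.+1) (H m.+1).
  exact: decrease.
elim: n => [_|n IH nM]; first by rewrite big_geq// mulr0 subr0.
rewrite (num_area_eq hG hQ (hY n nM)) big_nat_recr//= mulrDr opprD addrA.
apply: le_trans (num_area_step hG hQ htau (feY n nM) (hX n nM) (hH n nM)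
  (hB1 n nM) (hvelocity n nM) (hcurvature n nM)) _.
by rewrite lerD2r IH// ltnW.
Qed.
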